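(* Let $(X,f)$ be a compact dynamical system and let $x,y\in X$ be such that $x\,\mathcal{C}\,y$. Let $\{S_n\}_{n=1}^\infty$ be a complete sequence of order-compatible nested chains from $x$ to $y$, and set $S=\bigcup_n\widehat{S_n}$. Let $H$ be the set of all chain components $K\subseteq X$ such that $K\cap S\neq\varnothing$. Then $(H,\le_{\mathrm{Conley}})$ is a linearly ordered set.
   Context: A compact dynamical system $(X,f)$ is a compact metric space $(X,d)$ with a continuous map $f:X\to X$. For $\varepsilon>0$, an $\varepsilon$-chain from $x$ to $y$ is a finite indexed sequence $C:x_0,\dots,x_m$ in $X$ with $m\ge1$, $x_0=x$, $x_m=y$, $d(f(x_i),x_{i+1})<\varepsilon$ for $0\le i<m$; its support is $\widehat C=\{x_0,\dots,x_m\}$. $x\,\mathcal{C}\,y$ means that for every $\varepsilon>0$ there is an $\varepsilon$-chain from $x$ to $y$. Chain components are the equivalence classes of the relation ''$x\,\mathcal{C}\,y$ and $y\,\mathcal{C}\,x$'' on the set of points $x$ with $x\,\mathcal{C}\,x$. For chain components $K,K'$: $K\le_{\mathrm{Conley}}K'$ iff there exist $u\in K$, $v\in K'$ with $u\,\mathcal{C}\,v$; this is a partial order on chain components. A chain is acyclic if $x_1,\dots,x_{m-1}$ are pairwise distinct and none equals $x_0$ or $x_m$ ($x_0=x_m$ is allowed). An acyclic chain $S_n$ induces on $\widehat{S_n}$ the relation $\le_n$: $u\le_n v$ iff $u=x_i,v=x_j$ for some $i\le j$ (a linear order on $\widehat{S_n}\setminus\{x,y\}$). A complete sequence of order-compatible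 nested chains from $x$ to $y$ is a sequence $\{S_n\}$ where $S_n$ is an acyclic $\varepsilon_n$-chain from $x$ to $y$ for some positive reals $\varepsilon_n$ converging monotonically to $0$, $\widehat{S_n}\subseteq\widehat{S_{n+1}}$, and $u\le_n v$ implies $u\le_{n+1}v$ for $u,v\in\widehat{S_n}$. *)

(* Defs.v *)
From HB Require Import structures.
From mathcomp Require Import all_boot all_order all_algebra.
From mathcomp Require Import all_classical all_reals all_analysis.

Set Implicit Arguments.
Unset Strict Implicit.
Unset Printing Implicit Defensive.

Import Order.TTheory GRing.Theory Num.Theory.
Import numFieldNormedType.Exports.

Local Open Scope classical_set_scope.
Local Open Scope ring_scope.

Section ChainDefs.
Context {R : realType} {X : metricType R}.
Implicit Types (f : X -> X) (e : R) (x y u v : X) (C : seq X) (K : set X).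

(* An indexed sequence x_0, ..., x_m is the list [:: x_0; ...; x_m]; having the
   shape [x :: rcons s y] says exactly that m >= 1, x_0 = x and x_m = y, with
   [s] listing x_1, ..., x_{m-1}. *)
Definition is_chain f e x y C : Prop :=
  exists2 s : seq X, C = x :: rcons s y &
    path (fun u v => mdist (f u) v < e) x (rcons s y).

Definition chain_support C : set X := [set` C].

Definition acyclic C : Prop :=
  exists x s y, C = x :: rcons s y /\ [/\ uniq s, x \notin s & y \notin s].

(* [onth C i = Some u] says that u is the term x_i of C, with i in range. *)
Definition chain_le C u v : Prop :=
  exists i j : nat, [/\ (i <= j)%N, onth C i = Some u & onth C j = Some v].

Definition chain_rel f x y : Prop :=
  forall e, 0 < e -> exists C, is_chain f e x y C.

Definition chain_recurrent f : set X := [set x | chain_rel f x x].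

Definition chain_equiv f x y : Prop := chain_rel f x y /\ chain_rel f y x.

Definition chain_component f K : Prop :=
  exists2 x, chain_recurrent f x &
    K = [set y | chain_recurrent f y /\ chain_equiv f x y].

Definition conley_le f K K' : Prop :=
  exists u v, [/\ K u, K' v & chain_rel f u v].

Definition complete_nested_chains f x y (S : nat -> seq X) : Prop :=
  [/\ exists eps : nat -> R,
        [/\ forall n, 0 < eps n,
            nonincreasing_seq eps,
            eps n @[n --> \oo] --> (0 : R)
          & forall n, is_chain f (eps n) x y (S n)],
      forall n, acyclic (S n),
      forall n, chain_support (S n) `<=` chain_support (S n.+1)
    & forall n u v, chain_support (S n) u -> chain_support (S n) v ->
        chain_le (S n) u v -> chain_le (S n.+1) u v].

End ChainDefs.

Definition linearly_ordered (T : Type) (A : set T) (le : T -> T -> Prop) : Prop :=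
  [/\ forall a, A a -> le a a,
      forall a b, A a -> A b -> le a b -> le b a -> a = b,
      forall a b c, A a -> A b -> A c -> le a b -> le b c -> le a c
    & total_on A le].

(* Main.v *)
Require Import Defs.
From mathcomp Require Import all_boot all_order all_algebra.
From mathcomp Require Import all_classical all_reals all_analysis.
Import Order.TTheory GRing.Theory Num.Theory.
Import numFieldNormedType.Exports.
Local Open Scope classical_set_scope.
Local Open Scope ring_scope.

(** Two points [u <> v] of the union of the supports both lie in all [S n] with
    [n] large, and order compatibility makes one of them, say [u], precede the
    other in every such [S n]. The segment of [S n] from [u] to [v] is then an
    [eps n]-chain, and [eps n] tends to [0], so [u] is chain related to [v]. *)

(** Strictness of [i < j] guarantees at least one step from [u] to [v], as the shape [rcons s v]
    demands. *)
Lemma path_segment {T : Type} {r : rel T} {a : T} {p : seq T} {i j : nat}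
    {u v : T} :
  path r a p -> (i < j)%N ->
  onth (a :: p) i = Some u -> onth (a :: p) j = Some v ->
  exists s, path r u (rcons s v).
Proof.
elim: p a i j u => [|b p IH] a i [|j] //= u; first by case: j.
move=> /andP[rab rp]; case: i => [_ [<-] jv|i]; last exact: (IH b i j u rp).
case: j jv => [[<-]|j jv]; first by exists [::]; rewrite /= rab.
(* Here [u] is the head [a]: the segment is taken from the next term [b], and [b] becomes its first
   interior point. *)
by have [s ps] := IH b 0 j.+1 b rp isT erefl jv; exists (b :: s); rewrite /= rab.
Qed.

Section ChainRelation.
Context {R : realType} {X : metricType R} {f : X -> X}.

Lemma chain_rel_trans {x y z : X} :
  chain_rel f x y -> chain_rel f y z -> chain_rel f x z.
Proof.
move=> xy yz e e0; have [_ [s _ ps]] := xy e e0; have [_ [t _ pt]] := yz e e0.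
(* Concatenation turns the shared endpoint [y] into an interior term. *)
exists (x :: rcons (rcons s y ++ t) z); eexists; first reflexivity.
by rewrite rcons_cat cat_path ps last_rcons.
Qed.

(** Both points are linked through the representative of [K]. The case [u = v] yields reflexivity of
    [conley_le]. *)
Lemma chain_component_rel {K : set X} {u v : X} :
  chain_component f K -> K u -> K v -> chain_rel f u v.
Proof.
move=> [x _ ->] [_ [_ ux]] [_ [xv _]]; exact: chain_rel_trans ux xv.
Qed.

Lemma chain_component_eq {K L : set X} {u v : X} :
  chain_component f K -> chain_component f L -> K u -> L v ->
  chain_equiv f u v -> K = L.
Proof.
move=> [x _ ->] [y _ ->] [_ [xu ux]] [_ [yv vy]] [uv vu].
have xy : chain_rel f x y.
  exact: chain_rel_trans xu (chain_rel_trans uv vy).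
have yx : chain_rel f y x.
  exact: chain_rel_trans yv (chain_rel_trans vu ux).
apply/seteqP; split=> z [zz [az za]]; split=> //; split.
- exact: chain_rel_trans yx az.
- exact: chain_rel_trans za xy.
- exact: chain_rel_trans xy az.
- exact: chain_rel_trans za yx.
Qed.

(** The witnesses hidden in [conley_le] can be traded for any chosen points of [K] and [L], so that
    successive comparisons meet at a common point. *)
Lemma conley_le_rel {K L : set X} {u v : X} :
  chain_component f K -> chain_component f L -> K u -> L v ->
  conley_le f K L -> chain_rel f u v.
Proof.
move=> cK cL Ku Lv [a [b [Ka Lb ab]]].
apply: chain_rel_trans (chain_component_rel cK Ku Ka) _.
exact: chain_rel_trans ab (chain_component_rel cL Lb Lv).
Qed.

Lemma chain_le_total {C : seq X} {u v : X} :
  chain_support C u -> chain_support C v -> chain_le C u v \/ chain_le C v u.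
Proof.
move=> /onthP[i iu] /onthP[j jv]; have [ij|/ltnW ji] := leqP i j.
- by left; exists i, j.
- by right; exists j, i.
Qed.

Lemma chain_le_segment {e : R} {x y u v : X} {C : seq X} :
  is_chain f e x y C -> chain_le C u v -> u <> v ->
  exists D, is_chain f e u v D.
Proof.
move=> [s -> ps] [i [j [ij iu jv]]] uv.
(* Equal indices would carry the same point, against [u <> v]. *)
have {}ij : (i < j)%N.
  rewrite ltn_neqAle ij andbT; apply/eqP => eij; apply: uv.
  by move: iu; rewrite eij jv => -[].
have [t pt] := path_segment ps ij iu jv.
by exists (u :: rcons t v), t.
Qed.

Section NestedChains.
Context {x y : X} {S : nat -> seq X}.
Context (hS : complete_nested_chains f x y S).

Lemma nested_chains_support {m n : nat} :
  (m <= n)%N -> chain_support (S m) `<=` chain_support (S n).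
Proof.
have [_ _ sub _] := hS; move=> /subnK <-; elim: (n - m)%N => // k IH.
exact: subset_trans IH (sub _).
Qed.

Lemma nested_chains_le {m n : nat} {u v : X} :
  (m <= n)%N -> chain_support (S m) u -> chain_support (S m) v ->
  chain_le (S m) u v -> chain_le (S n) u v.
Proof.
have [_ _ _ mono] := hS; move=> /subnK <- um vm uv.
elim: (n - m)%N => // k IH; rewrite addSn.
by apply: mono => //; apply: (nested_chains_support (leq_addl _ _)).
Qed.

Lemma nested_chains_rel {n : nat} {u v : X} :
  chain_support (S n) u -> chain_support (S n) v -> chain_le (S n) u v ->
  u <> v -> chain_rel f u v.
Proof.
move=> un vn uv neq e e0; have [[eps [_ _ eps0 ch]] _ _ _] := hS.
(* Stage [maxn n N] is late enough both to inherit the order of [u] and [v] from stage [n] and to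
   have [eps] below [e]. *)
have [N _ hN] := cvgr_lt 0 eps0 e e0.
have [_ [s _ ps]] := chain_le_segment (ch (maxn n N))
  (nested_chains_le (leq_maxl n N) un vn uv) neq.
exists (u :: rcons s v), s => //; apply: sub_path ps => a b /= ab.
exact: lt_trans ab (hN _ (leq_maxr n N)).
Qed.

End NestedChains.
End ChainRelation.

Theorem theorem6p3 (R : realType) (X : metricType R) (f : X -> X)
  (cX : compact [set: X]) (cf : continuous f) (x y : X)
  (xCy : chain_rel f x y) (S : nat -> seq X)
  (hS : complete_nested_chains f x y S) :
  linearly_ordered
    [set K : set X | chain_component f K /\
                     K `&` (\bigcup_n chain_support (S n)) !=set0]
    (conley_le f).
Proof.
split.
- move=> K [cK [u [Ku _]]]; exists u, u; split=> //.
  exact: (chain_component_rel cK Ku Ku).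
- move=> K L [cK [u [Ku _]]] [cL [v [Lv _]]] KL LK.
  apply: (chain_component_eq cK cL Ku Lv).
  by split; [exact: conley_le_rel KL | exact: conley_le_rel LK].
- move=> K L M [cK [u [Ku _]]] [cL [v [Lv _]]] [cM [w [Mw _]]] KL LM.
  exists u, w; split=> //; apply: (@chain_rel_trans _ _ _ _ v).
    exact: conley_le_rel KL.
  exact: conley_le_rel LM.
- move=> K L [cK [u [Ku [m _ um]]]] [cL [v [Lv [n _ vn]]]].
  (* A common point gives no segment of positive length; its recurrence, from membership in [K],
     supplies the chains instead. *)
  have [uv|neq] := pselect (u = v).
    left; exists u, v; split=> //; rewrite -uv.
    exact: (chain_component_rel cK Ku Ku).
  (* Both points are moved to the common stage [maxn m n], where their positions can be compared. *)
  have {}um := nested_chains_support hS (leq_maxl m n) _ um.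
  have {}vn := nested_chains_support hS (leq_maxr m n) _ vn.
  have [uv|vu] := chain_le_total um vn.
  + left; exists u, v; split=> //; exact: (nested_chains_rel hS um vn uv neq).
  + right; exists v, u; split=> //; exact: (nested_chains_rel hS vn um vu (nesym neq)).
Qed.
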